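(* There are no continuous $\mathbb{C}$-equivariant maps $\beta:\mathrm{Free}(\mathcal{D}^+)\to\mathcal{E}\setminus\{\text{constants}\}$. In particular, there are no continuous $\mathbb{C}$-equivariant right-inverses to the divisor map $\mathrm{div}:\mathcal{E}_{\neq0}\to\mathcal{D}^+$ defined on all of $\mathrm{Free}(\mathcal{D}^+)$.
   Context: $\mathcal{E}$ is the space of entire functions on $\mathbb{C}$ with the topology of uniform convergence on compact sets, and $\mathcal{E}_{\neq0}=\mathcal{E}\setminus\{0\}$. A positive divisor is a map $d:\mathbb{C}\to\{0,1,2,\dots\}$ whose support is a closed discrete subset of $\mathbb{C}$; $\mathcal{D}^+$ is the space of positive divisors, with divisors identified with the measures $\sum_zd(z)\delta_z$ and equipped with the vague topology (the weakest topology making $d\mapsto\sum_zf(z)d(z)$ continuous for every compactly supported continuous $f$). $\mathrm{div}(f)(z)$ is the order of vanishing of $f$ at $z$. The additive group $\mathbb{C}$ acts by $(w\cdot f)(z)=f(z+w)$ and $(w\cdot d)(z)=d(z+w)$. $\mathrm{Free}(\mathcal{D}^+)$ is the set of divisors with trivial stabilizer, with the subspace topology. A right-inverse to $\mathrm{div}$ on $\mathrm{Free}(\mathcal{D}^+)$ is a map $\xi:\mathrm{Free}(\mathcal{D}^+)\to\mathcal{E}_{\neq0}$ with $\mathrm{div}(\xi(d))=d$ for all $d\in \mathrm{Free}(\mathcal{D}^+)$. *)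

(* Defs.v *)
From HB Require Import structures.
From mathcomp Require Import all_boot all_order all_algebra.
From mathcomp Require Import all_classical all_reals all_analysis.
From mathcomp Require Import complex.

Set Implicit Arguments.
Unset Strict Implicit.
Unset Printing Implicit Defensive.

Import Order.TTheory GRing.Theory Num.Theory.
Import numFieldNormedType.Exports.

Local Open Scope classical_set_scope.
Local Open Scope ring_scope.
Local Open Scope complex_scope.

(* The library gives R[i] its field structure and its norm, but no topology.
   Here R[i] becomes a normed space over itself. *)
HB.instance Definition _ (R : realType) :=
  NormedModule.copy R[i] (R[i] : numClosedFieldType)^o.

(* The action of C on functions; it is used both for entire functions and for
   divisors. *)
Definition translate (R : realType) (T : Type) (w : R[i]) (f : R[i] -> T) :
  R[i] -> T := fun z => f (z + w).

(* [derivable] at [z] in direction 1 is complex differentiability, because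
   R[i] is taken as a normed space over R[i]. The sets below are sets of
   points of the space of all functions with the topology of uniform
   convergence on compact sets; as types (via [set_type]) they carry the
   subspace topology. *)
Definition entire (R : realType) : set {family compact, R[i] -> R[i]} :=
  [set f | forall z : R[i], derivable (f : R[i] -> R[i]) z 1].

Arguments entire : clear implicits.

Definition constants (R : realType) : set {family compact, R[i] -> R[i]} :=
  [set f | exists c : R[i], forall z, f z = c].

Arguments constants : clear implicits.

Definition nonconstant_entire (R : realType) := entire R `\` constants R.

Definition nonzero_entire (R : realType) :=
  entire R `\` [set f | forall z, f z = 0].

Arguments nonconstant_entire : clear implicits.
Arguments nonzero_entire : clear implicits.

Section Divisors.
Variable R : realType.

Definition div_support (d : R[i] -> nat) : set R[i] := [set z | d z != 0%N].

Definition positive_divisor : set (R[i] -> nat) :=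
  [set d | closed (div_support d) /\
           div_support d `<=` isolated (div_support d)].

Definition test_function : set (R[i] -> R) :=
  [set f | continuous f /\ compact (closure [set z | f z != 0])].

(* The integral of f against the measure \sum_z d(z) \delta_z. The library
   sets the sum to 0 when infinitely many terms are nonzero, which cannot
   happen here: supp f is compact and supp d is closed and discrete. *)
Definition pairing (d : positive_divisor) : {ptws test_function -> R} :=
  fun f => \sum_(z \in [set: R[i]]) sval f z * (sval d z)%:R.

(* The vague topology: the initial topology for all the maps
   [d |-> pairing d f]. *)
Definition divisor : Type := initial_topology pairing.

HB.instance Definition _ := Topological.on divisor.

Definition multiplicity (d : divisor) : R[i] -> nat := sval (d : positive_divisor).

Definition free_divisor : set divisor :=
  [set d | forall w : R[i], translate w (multiplicity d) = multiplicity d -> w = 0].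

Lemma positive_divisor_translate w (d : R[i] -> nat) :
  positive_divisor d -> positive_divisor (translate w d).
Proof.
have tc (v : R[i]) : continuous (fun z : R[i] => z + v).
  move=> z; apply: (@cvgD _ R[i] _ (nbhs z) _ id (cst v)).
    exact: cvg_id.
  exact: cvg_cst.
move=> [dc di]; split.
  by have /continuous_closedP/(_ _ dc) := tc w.
move=> z dz; split; first exact/mem_set.
have [_ [V zV VE]] := di _ dz.
exists ((fun z => z + w) @^-1` V); first exact: tc.
apply/seteqP; split=> [x [Vx dx]|x ->].
  have : [set z + w] (x + w) by rewrite -VE.
  by move=> /addIr.
by have : [set z + w] (z + w) by []; rewrite -VE.
Qed.

Definition translate_divisor (w : R[i]) (d : divisor) : divisor :=
  SigSub (mem_set (positive_divisor_translate w (set_mem (valP d)))).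

Lemma free_divisor_translate w (d : divisor) :
  free_divisor d -> free_divisor (translate_divisor w d).
Proof.
move=> dF v h; apply: dF; apply/funext => z.
have : multiplicity d (z - w + v + w) = multiplicity d (z - w + w).
  exact: (congr1 (fun g : R[i] -> nat => g (z - w)) h).
by rewrite subrK addrAC subrK.
Qed.

Definition translate_free (w : R[i]) (d : free_divisor) : free_divisor :=
  SigSub (mem_set (@free_divisor_translate w _ (set_mem (valP d)))).

End Divisors.

Arguments positive_divisor : clear implicits.
Arguments test_function : clear implicits.
Arguments free_divisor : clear implicits.

(* The order of vanishing: the n such that the n-th derivative is the first
   one not vanishing at z. It exists for every nonzero entire function, so the
   default 0 plays no role on [nonzero_entire]. *)
Definition div (R : realType) (f : R[i] -> R[i]) (z : R[i]) : nat :=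
  xget 0%N [set n | derive1n n f z != 0 /\
                    forall k, (k < n)%N -> derive1n k f z = 0].

Definition equivariant (R : realType) (A : set {family compact, R[i] -> R[i]})
    (b : free_divisor R -> A) : Prop :=
  forall (w : R[i]) (d : free_divisor R),
    sval (b (translate_free w d)) = translate w (sval (b d)).

(* Main.v *)
Require Import Defs.
From HB Require Import structures.
From mathcomp Require Import all_boot all_order all_algebra.
From mathcomp Require Import all_classical all_reals all_analysis.
From mathcomp Require Import complex ring lra zify.

(** An equivariant map is determined on the orbit of a divisor [d] by the single
number [beta d 0], because [beta d w = beta (w . d) 0]. If [d] lies in a compact
translation-invariant set of free divisors, then continuity of [beta] bounds
these numbers, so [beta d] is a bounded entire function, hence constant by
Liouville's theorem ([equivariant_constant]). This excludes nonconstant values;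
and a right-inverse [xi] of [div] would take a constant nonzero value on [d],
whose divisor is 0, although a free divisor is not 0.

The compact invariant set is a family of quasi-periodically perturbed square
lattices: the divisors [free_grid (p, q)] are the products of two subsets of the
line, each of the form [n - x + cos (t + 2 n) / 8] with [n] an integer. A
translation of the plane only changes the two offsets [x]; and since replacing
[x] by [x + m] amounts to the rotation [t + 2 m] of the phase, all the parameters
can be brought back to [0 <= x <= 1] and [0 <= t <= 2 pi] ([sites_reduce]). The
perturbation depends continuously on the parameters, which gives continuity in
the vague topology ([grid_divisor_continuous]). Freeness comes from the
irrationality of the rotation: a period of the perturbed sequence would be an
integer shift under which the phases change trivially ([sites_aperiodic]).

Entire functions here are merely differentiable at every point, so Liouville's
theorem goes through Goursat's lemma ([goursat]), proved by bisection for real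
differential forms on rectangles. It is applied to
[h (z) = (f (exp z) - f 0) / exp z]. As [h] has period [2 i pi], the integral of
[h] over a vertical segment of length [2 pi] does not depend on its abscissa; far
to the left [h] is close to [f'(0)], and far to the right it is close to 0, so
[f'(0) = 0]. The same holds at any other point by translation, so [f] is
constant. *)

Set Implicit Arguments.
Unset Strict Implicit.
Unset Printing Implicit Defensive.

Import Order.TTheory GRing.Theory Num.Theory.
Import numFieldNormedType.Exports.

Local Open Scope classical_set_scope.
Local Open Scope ring_scope.
Local Open Scope complex_scope.

(** * Goursat's lemma on rectangles *)

Section Goursat.
Variable R : realType.
Implicit Types (g : R -> R) (P Q : R -> R -> R).
Notation mu := (@lebesgue_measure R).

Definition segint g (a b : R) : R := \int[mu]_(x in `[a, b]) g x.

Lemma continuous_segint_integrable g a b :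
  continuous g -> mu.-integrable `[a, b] (EFin \o g).
Proof.
move=> gc; apply: continuous_compact_integrable; first exact: segment_compact.
exact: continuous_subspaceT.
Qed.

Lemma segint_chasles g a m b : continuous g -> a <= m -> m <= b ->
  segint g a b = segint g a m + segint g m b.
Proof.
move=> gc am mb.
have := @Rintegral_itvB R g (BLeft a) (BRight b) m
  (continuous_segint_integrable a b gc).
rewrite !bnd_simp => /(_ am mb) E.
rewrite /segint -[X in _ + X]Rintegral_itv_obnd_cbnd -?E; last first.
  apply: integrableS (continuous_segint_integrable m b gc) => //.
  exact: subset_itv_oc_cc.
by rewrite addrC subrK.
Qed.

Lemma segintD g1 g2 a b : continuous g1 -> continuous g2 ->
  segint (fun x => g1 x + g2 x) a b = segint g1 a b + segint g2 a b.
Proof.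
by move=> c1 c2; rewrite /segint RintegralD//; exact: continuous_segint_integrable.
Qed.

Lemma segint_near_cst g a b k e : continuous g -> a <= b ->
  (forall x, a <= x <= b -> `|g x - k| <= e) ->
  `|segint g a b - k * (b - a)| <= e * (b - a).
Proof.
move=> gc ab ge.
have cst r : \int[mu]_(x in `[a, b]) r = r * (b - a).
  by rewrite Rintegral_cst//= lebesgue_measure_itv/= lte_fin; case: ltgtP ab => //= ->;
    rewrite subrr.
have kc (r : R) : continuous (fun _ : R => r) by move=> ?; exact: cvg_cst.
rewrite -!cst /segint -RintegralB//; try exact: continuous_segint_integrable.
have gkc : continuous (fun x => g x - k).
  by move=> x; apply: cvgB; [exact: gc|exact: cvg_cst].
apply: (le_trans (le_normr_Rintegral _ (continuous_segint_integrable a b gkc))) => //.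
have nc : continuous (fun x => `|g x - k|).
  by move=> x; apply: cvg_norm; exact: gkc.
apply: le_Rintegral => //; exact: continuous_segint_integrable.
Qed.

(** The integral of [P dx + Q dy] along the boundary. Opposite sides are grouped
under one integral sign, so that an affine form leaves constant integrands:
evaluating its circulation needs no primitive. *)
Definition circulation P Q (a b c d : R) : R :=
  segint (fun x => P x c - P x d) a b + segint (fun y => Q b y - Q a y) c d.

Definition continuous_each P :=
  (forall y, continuous (fun x => P x y)) /\ (forall x, continuous (P x)).

Lemma circulation_splitx P Q a m b c d :
  continuous_each P -> continuous_each Q -> a <= m -> m <= b ->
  circulation P Q a b c d = circulation P Q a m c d + circulation P Q m b c d.
Proof.
move=> [Px Py] [Qx Qy] am mb; rewrite /circulation (@segint_chasles _ a m b)//; last first.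
  by move=> x; apply: cvgB; exact: Px.
rewrite addrACA -segintD; first last.
- by move=> x; apply: cvgB; exact: Qy.
- by move=> x; apply: cvgB; exact: Qy.
by congr (_ + _); congr segint; apply/funext => y; ring.
Qed.

Lemma circulation_splity P Q a b c m d :
  continuous_each P -> continuous_each Q -> c <= m -> m <= d ->
  circulation P Q a b c d = circulation P Q a b c m + circulation P Q a b m d.
Proof.
move=> [Px Py] [Qx Qy] am mb; rewrite /circulation (@segint_chasles _ c m d)//; last first.
  by move=> x; apply: cvgB; exact: Qy.
rewrite addrACA -segintD; first last.
- by move=> x; apply: cvgB; exact: Px.
- by move=> x; apply: cvgB; exact: Px.
by congr (_ + _); congr segint; apply/funext => x; ring.
Qed.

(** The form [P dx + Q dy] is differentiable at every point and its differential
there is symmetric: the same [B] is both the [y]-derivative of [P] and the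
[x]-derivative of [Q]. *)
Definition pointwise_closed P Q := forall x0 y0, exists A B C, forall e, 0 < e ->
  exists2 r, 0 < r & forall x y, `|x - x0| <= r -> `|y - y0| <= r ->
  `|P x y - (P x0 y0 + A * (x - x0) + B * (y - y0))| <= e * (`|x - x0| + `|y - y0|) /\
  `|Q x y - (Q x0 y0 + B * (x - x0) + C * (y - y0))| <= e * (`|x - x0| + `|y - y0|).

(** The affine part of a closed form has circulation 0, so only the error term
counts: it is [o(s)] on a boundary of length [O(s)], where [s] is the size of the
rectangle. *)
Lemma circulation_small P Q x0 y0 A B C e r a b c d :
  continuous_each P -> continuous_each Q -> 0 <= e ->
  (forall x y, `|x - x0| <= r -> `|y - y0| <= r ->
  `|P x y - (P x0 y0 + A * (x - x0) + B * (y - y0))| <= e * (`|x - x0| + `|y - y0|) /\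
  `|Q x y - (Q x0 y0 + B * (x - x0) + C * (y - y0))| <= e * (`|x - x0| + `|y - y0|)) ->
  a <= x0 -> x0 <= b -> c <= y0 -> y0 <= d -> b - a <= r -> d - c <= r ->
  `|circulation P Q a b c d| <= 2 * e * ((b - a) + (d - c)) ^+ 2.
Proof.
move=> [Px Py] [Qx Qy] e0 H ax xb cy yd br dr.
pose s := (b - a) + (d - c).
have near x y : a <= x <= b -> c <= y <= d ->
  `|P x y - (P x0 y0 + A * (x - x0) + B * (y - y0))| <= e * s /\
  `|Q x y - (Q x0 y0 + B * (x - x0) + C * (y - y0))| <= e * s.
  move=> /andP[? ?] /andP[? ?].
  have hx : `|x - x0| <= b - a by rewrite ler_norml; apply/andP; split; lra.
  have hy : `|y - y0| <= d - c by rewrite ler_norml; apply/andP; split; lra.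
  have [h1 h2] := H x y (le_trans hx br) (le_trans hy dr).
  have es : e * (`|x - x0| + `|y - y0|) <= e * s by rewrite ler_wpM2l// lerD.
  by split; [exact: le_trans h1 es|exact: le_trans h2 es].
have ab : a <= b by exact: le_trans xb.
have cd : c <= d by exact: le_trans yd.
have I1 : `|segint (fun x => P x c - P x d) a b - (B * (c - d)) * (b - a)|
     <= (2 * (e * s)) * (b - a).
  apply: segint_near_cst => // [x|x xab].
    by apply: cvgB; exact: Px.
  have [h1 _] := near x c xab (introT andP (conj (lexx _) cd)).
  have [h2 _] := near x d xab (introT andP (conj cd (lexx _))).
  move: h1 h2; rewrite !ler_norml => /andP[? ?] /andP[? ?].
  by apply/andP; split; lra.
have I2 : `|segint (fun y => Q b y - Q a y) c d - (B * (b - a)) * (d - c)|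
     <= (2 * (e * s)) * (d - c).
  apply: segint_near_cst => // [x|x xab].
    by apply: cvgB; exact: Qy.
  have [_ h1] := near b x (introT andP (conj ab (lexx _))) xab.
  have [_ h2] := near a x (introT andP (conj (lexx _) ab)) xab.
  move: h1 h2; rewrite !ler_norml => /andP[? ?] /andP[? ?].
  by apply/andP; split; lra.
rewrite /circulation -/s.
apply: (@le_trans _ _ (2 * (e * s) * (b - a) + 2 * (e * s) * (d - c))).
  apply: le_trans (lerD I1 I2); apply: le_trans (ler_normD _ _).
  by rewrite le_eqVlt; apply/orP; left; apply/eqP; congr `|_|; ring.
by rewrite -mulrDr -/s le_eqVlt; apply/orP; left; apply/eqP; ring.
Qed.

(** The left ends increase, the right ends decrease, so the supremum of the left
ends lies in all the intervals. *)
Lemma nested_halves (x : nat -> R) (L : R) : 0 <= L ->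
  (forall n, x n.+1 = x n \/ x n.+1 = x n + L / 2 ^+ n.+1) ->
  exists x0, forall n, x n <= x0 <= x n + L / 2 ^+ n.
Proof.
move=> L0 H.
have half n : L / 2 ^+ n = L / 2 ^+ n.+1 + L / 2 ^+ n.+1.
  rewrite exprS; field.
  by rewrite expf_neq0.
have pos n : 0 <= L / 2 ^+ n by rewrite divr_ge0// exprn_ge0.
have inc n k : x n <= x (n + k)%N.
  elim: k => [|k IH]; first by rewrite addn0.
  by rewrite addnS; case: (H (n + k)%N) => ->; rewrite ?(le_trans IH)// lerDl.
have dec n k : x (n + k)%N + L / 2 ^+ (n + k) <= x n + L / 2 ^+ n.
  elim: k => [|k IH]; first by rewrite addn0.
  apply: le_trans IH; rewrite addnS (half (n + k)%N).
  by case: (H (n + k)%N) => ->; rewrite addrA ?lerDl.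
have ub n : ubound (range x) (x n + L / 2 ^+ n).
  move=> _ [m _ <-]; case: (leqP m n) => mn.
    by rewrite -(subnKC mn) (le_trans (inc m (n - m)%N))// lerDl.
  rewrite -(subnKC (ltnW mn)) (le_trans _ (dec n (m - n)%N))// lerDl; exact: pos.
exists (sup (range x)) => n; apply/andP; split.
  by apply: ub_le_sup; [exists (x 0%N + L / 2 ^+ 0); exact: ub | exists n].
by apply: ge_sup; [exists (x 0%N), 0%N | exact: ub].
Qed.

(** If the circulation around a rectangle is not 0, one of its four quarters has at
least a quarter of it, and so on: along the nested rectangles the circulation
decays no faster than the area, against [circulation_small] at the limit
point. *)
Theorem goursat P Q a b c d : continuous_each P -> continuous_each Q ->
  pointwise_closed P Q -> a <= b -> c <= d -> circulation P Q a b c d = 0.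
Proof.
move=> Pc Qc cl ab cd; apply/eqP/negPn/negP => W0.
pose L := b - a; pose K := d - c; pose eta := `|circulation P Q a b c d|.
have eta0 : 0 < eta by rewrite normr_gt0.
have L0 : 0 <= L by rewrite subr_ge0.
have K0 : 0 <= K by rewrite subr_ge0.
pose W n (p : R * R) := circulation P Q p.1 (p.1 + L / 2 ^+ n) p.2 (p.2 + K / 2 ^+ n).
pose bad n p := eta / 4 ^+ n <= `|W n p|.
pose next n (p q : R * R) :=
  (q.1 = p.1 \/ q.1 = p.1 + L / 2 ^+ n.+1) /\ (q.2 = p.2 \/ q.2 = p.2 + K / 2 ^+ n.+1).
have step n p : exists q, bad n p -> bad n.+1 q /\ next n p q.
  case: (pselect (exists2 q, bad n.+1 q & next n p q)) => [[q bq nq]|no].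
    by exists q.
  exists p => bp; exfalso.
  have small q : next n p q -> `|W n.+1 q| < eta / 4 ^+ n.+1.
    by move=> nq; rewrite ltNge; apply/negP => bq; apply: no; exists q.
  have half (M : R) : M / 2 ^+ n = M / 2 ^+ n.+1 + M / 2 ^+ n.+1.
    by rewrite exprS; field; rewrite expf_neq0.
  have pos (M : R) : 0 <= M -> 0 <= M / 2 ^+ n.+1.
    by move=> M0; rewrite divr_ge0// exprn_ge0.
  have := pos _ L0; have := pos _ K0 => pK pL.
  move: bp; rewrite /bad /W leNgt => /negP; apply.
  rewrite !half (@circulation_splitx _ _ _ (p.1 + L / 2 ^+ n.+1))//; first last.
  - by rewrite addrA lerDl.
  - by rewrite lerDl.
  rewrite (@circulation_splity _ _ p.1 _ _ (p.2 + K / 2 ^+ n.+1))//; first last.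
  - by rewrite addrA lerDl.
  - by rewrite lerDl.
  rewrite (@circulation_splity _ _ (p.1 + L / 2 ^+ n.+1) _ _ (p.2 + K / 2 ^+ n.+1))//; first last.
  - by rewrite addrA lerDl.
  - by rewrite lerDl.
  rewrite ![p.1 + (_ + _)]addrA ![p.2 + (_ + _)]addrA.
  have e4 : eta / 4 ^+ n = eta / 4 ^+ n.+1 + eta / 4 ^+ n.+1 + (eta / 4 ^+ n.+1 + eta / 4 ^+ n.+1).
    by rewrite exprS; field; rewrite expf_neq0.
  have s1 := small (p.1, p.2) (conj (or_introl erefl) (or_introl erefl)).
  have s2 := small (p.1, p.2 + K / 2 ^+ n.+1) (conj (or_introl erefl) (or_intror erefl)).
  have s3 := small (p.1 + L / 2 ^+ n.+1, p.2) (conj (or_intror erefl) (or_introl erefl)).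
  have s4 := small (p.1 + L / 2 ^+ n.+1, p.2 + K / 2 ^+ n.+1) (conj (or_intror erefl) (or_intror erefl)).
  move: s1 s2 s3 s4; rewrite /W /= e4 !ltr_norml.
  move=> /andP[? ?] /andP[? ?] /andP[? ?] /andP[? ?].
  by apply/andP; split; lra.
have [F HF] := choice (fun np : nat * (R * R) => step np.1 np.2).
pose fix s n := if n is m.+1 then F (m, s m) else (a, c).
have bads n : bad n (s n).
  elim: n => [|n IH] /=; last by have [] := HF (n, s n) IH.
  by rewrite /bad /W /= !expr0 !divr1 /L /K ![_ + (_ - _)]addrC !subrK /eta lexx.
have nexts n : next n (s n) (s n.+1) by have [] := HF (n, s n) (bads n).
have [x0 Hx] := @nested_halves (fun n => (s n).1) L L0 (fun n => (nexts n).1).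
have [y0 Hy] := @nested_halves (fun n => (s n).2) K K0 (fun n => (nexts n).2).
have [A [B [C ABC]]] := cl x0 y0.
have LK : 0 < (L + K) ^+ 2 + 1 by rewrite ltr_wpDl// exprn_ge0// addr_ge0.
(* The bound of circulation_small is then [2 e (L + K)^2 / 4^n < eta / 4^n]; the
   added 1 keeps the denominator positive for degenerate rectangles. *)
have e0 : 0 < eta / (2 * ((L + K) ^+ 2 + 1)) by rewrite divr_gt0// mulr_gt0.
have [r r0 Hr] := ABC _ e0.
have [n hn] : exists n, L / 2 ^+ n <= r /\ K / 2 ^+ n <= r.
  pose m := Num.bound ((L + K) / r); exists m.
  have mb : (L + K) / r < 2 ^+ m.
    have LKr : 0 <= (L + K) / r by rewrite divr_ge0 ?(ltW r0)// addr_ge0.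
    apply: lt_trans (archi_boundP LKr) _.
    by rewrite -natrX ltr_nat ltn_expl.
  have mb' : L + K <= r * 2 ^+ m.
    by move: mb; rewrite ltr_pdivrMr// mulrC => /ltW.
  by split; rewrite ler_pdivrMr ?exprn_gt0// (le_trans _ mb')// ?lerDl ?lerDr.
have := bads n; rewrite /bad; apply/negP; rewrite -ltNge /W.
have /andP[x1 x2] := Hx n; have /andP[y1 y2] := Hy n.
apply: le_lt_trans (circulation_small Pc Qc (ltW e0) Hr x1 x2 y1 y2 _ _) _.
- by rewrite addrAC subrr add0r; case: hn.
- by rewrite addrAC subrr add0r; case: hn.
rewrite ![_ + _ - _]addrAC !subrr !add0r -mulrDl expr_div_n -exprM mulnC exprM.
have -> : (2 : R) ^+ 2 = 4 by ring.
rewrite mulrA ltr_pM2r ?invr_gt0 ?exprn_gt0//.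
move: LK; set M := (L + K) ^+ 2 => LK.
have -> : 2 * (eta / (2 * (M + 1))) * M = eta * (M / (M + 1)).
  by field; rewrite gt_eqF.
by rewrite gtr_pMr// ltr_pdivrMr// mul1r ltrDl.
Qed.

End Goursat.

(** * First-order expansions over the reals and the complex numbers *)

Section Expansion.
Variable K : numFieldType.

Lemma is_derive_expansion (f : K -> K) (x d : K) :
  is_derive x 1 f d <->
  forall e, 0 < e -> \forall y \near x, `|f y - f x - d * (y - x)| <= e * `|y - x|.
Proof.
have key (y : K) e : y != x -> (`|d - (y - x)^-1 *: (f ((y - x) *: 1 + x) - f x)| <= e)
    = (`|f y - f x - d * (y - x)| <= e * `|y - x|).
  rewrite -subr_eq0 => yx; rewrite -ler_pdivrMr ?normr_gt0// -normrV ?unitfE// -normrM distrC.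
  congr (`|_| <= _); rewrite /GRing.scale /= mulr1 subrK; field; exact: yx.
have eqc : is_derive x 1 f d <-> (fun h : K => h^-1 *: (f (h *: 1 + x) - f x)) @ (0:K)^' --> d.
  split=> [[df <-]|c]; first exact: df.
  by split; [apply/cvg_ex; exists d | exact/cvg_lim].
rewrite eqc; split=> [/cvgrPdist_le H e /H|H].
  rewrite near_withinE !near_simpl (@near_shift K K^o x 0) => {}H; near=> y.
  have /= : ((fun t => t != 0 -> `|d - t^-1 *: (f (t *: 1 + x) - f x)| <= e) \o shift (0 - x)) y.
    by near: y.
  rewrite sub0r.
  have [->|yx] := eqVneq y x; first by rewrite !subrr mulr0 subr0 normr0 mulr0.
  by rewrite -key// subr_eq0; apply.
apply/cvgrPdist_le => e /H {}H; rewrite near_withinE !near_simpl (@near_shift K K^o x 0).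
near=> y; rewrite /= sub0r subr_eq0 => yx; rewrite key//; near: y; exact: H.
Unshelve. all: by end_near. Qed.

End Expansion.

Section ComplexNorm.
Variable R : realType.
Implicit Types (z w : R[i]).
Notation normc := (@Normc.normc R).

Lemma norm_normc z : `|z| = (normc z)%:C. Proof. by []. Qed.

Lemma normc_ge0 z : 0 <= normc z. Proof. by case: z => a b; exact: sqrtr_ge0. Qed.

Lemma normc_Re z : `|complex.Re z| <= normc z.
Proof. by rewrite -lecR -norm_normc; exact: normc_ge_Re. Qed.

Lemma normc_Im z : `|complex.Im z| <= normc z.
Proof.
case: z => a b /=; rewrite -(sqrtr_sqr b) ler_sqrt ?lerDr ?sqr_ge0//.
by rewrite addr_ge0 ?sqr_ge0.
Qed.

Lemma normc_ReIm z : normc z <= `|complex.Re z| + `|complex.Im z|.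
Proof.
case: z => a b /=.
have h : 0 <= `|a| + `|b| by rewrite addr_ge0.
rewrite -(ger0_norm h) -(sqrtr_sqr (_ + _)) ler_sqrt ?sqr_ge0//.
rewrite sqrrD !real_normK ?num_real// addrAC lerDl mulrn_wge0// mulr_ge0//.
Qed.

Lemma near_normcP z (P : set R[i]) :
  (\forall w \near z, P w) <-> exists2 r : R, 0 < r & forall w, normc (w - z) < r -> P w.
Proof.
split=> [/nbhs_normP [e /= e0 eP]|[r r0 rP]].
  have eE : e = (complex.Re e)%:C by rewrite RRe_real// gtr0_real.
  exists (complex.Re e); first by move: e0; rewrite eE ltcR.
  by move=> w wz; apply: eP; rewrite /= distrC norm_normc eE ltcR.
apply/nbhs_normP; exists r%:C; first by rewrite /= ltcR.
by move=> w /=; rewrite distrC norm_normc ltcR; exact: rP.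
Qed.

(** In the partial order of the complex numbers, positive numbers are real; so an
[e > 0] of a complex normed space is a real one. *)
Lemma complex_gt0_ind (P : R[i] -> Prop) :
  (forall e : R, 0 < e -> P e%:C) -> forall e : R[i], 0 < e -> P e.
Proof.
move=> H e e0; have eE : e = (complex.Re e)%:C by rewrite RRe_real// gtr0_real.
by rewrite eE; apply: H; move: e0; rewrite {1}eE ltcR.
Qed.

Lemma complex_deriveP (f : R[i] -> R[i]) z d :
  is_derive z 1 f d <-> forall e : R, 0 < e -> exists2 r : R, 0 < r &
   forall w, normc (w - z) < r -> normc (f w - f z - d * (w - z)) <= e * normc (w - z).
Proof.
rewrite is_derive_expansion; split=> [H e e0|H].
  have /near_normcP[r r0 rP] := H e%:C (etrans (ltcR _ _) e0).
  by exists r => // w /rP; rewrite !norm_normc -rmorphM/= lecR.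
apply: complex_gt0_ind => e /H[r r0 rP]; apply/near_normcP; exists r => // w /rP.
by rewrite !norm_normc -rmorphM/= lecR.
Qed.

Lemma real_deriveP (f : R -> R) (x d : R) :
  is_derive x 1 f d -> forall e : R, 0 < e -> exists2 r : R, 0 < r &
   forall y : R, `|y - x| < r -> `|f y - f x - d * (y - x)| <= e * `|y - x|.
Proof.
move=> /is_derive_expansion H e /H /nbhs_normP[r r0 rP].
by exists r => // y yx; apply: rP; rewrite /= distrC.
Qed.

Definition cexp z : R[i] :=
  (expR (complex.Re z) * cos (complex.Im z)) +i* (expR (complex.Re z) * sin (complex.Im z)).

Lemma cexpD z w : cexp (z + w) = cexp z * cexp w.
Proof.
case: z w => [a b] [c d]; rewrite /cexp /= expRD cosD sinD.
by apply/eqP; rewrite eq_complex /=; apply/andP; split; apply/eqP; ring.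
Qed.

Lemma normc_cexp z : normc (cexp z) = expR (complex.Re z).
Proof.
rewrite /cexp /= !exprMn -mulrDr cos2Dsin2 mulr1 sqrtr_sqr ger0_norm//.
Qed.

Lemma cexp_neq0 z : cexp z != 0.
Proof.
apply/negP => /eqP h; have := expR_gt0 (complex.Re z).
by rewrite -normc_cexp h Normc.normc0 ltxx.
Qed.

(** With [z = a + i b], split [e^a cos b - 1 - a] as
[(e^a - 1 - a) + e^a (cos b - 1)] and [e^a sin b - b] as
[e^a (sin b - b) + (e^a - 1) b]; each term is small by the first-order expansions
of the real exponential, sine and cosine at 0. *)
Lemma is_derive_cexp0 : is_derive (0 : R[i]) 1 cexp 1.
Proof.
apply/complex_deriveP => e e0.
(* The four terms below add up to at most [9 e' |w|] as soon as [e' <= 1]. *)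
pose e' := Num.min (e / 9) 1.
have e'0 : 0 < e' by rewrite lt_min divr_gt0//=.
have e'1 : e' <= 1 by rewrite ge_min lexx orbT.
have e'e : 9 * e' <= e by rewrite mulrC -ler_pdivlMr// ge_min lexx.
clearbody e'.
have [r1 r10 H1] := real_deriveP (is_derive_expR 0) e'0.
have [r2 r20 H2] := real_deriveP (is_derive_sin 0) e'0.
have [r3 r30 H3] := real_deriveP (is_derive_cos 0) e'0.
exists (Num.min e' (Num.min r1 (Num.min r2 r3))); first by rewrite !lt_min e'0 r10 r20 r30.
move=> w; rewrite !subr0 !lt_min => /and4P[we w1 w2 w3].
have := normc_Re w; have := normc_Im w.
case: w we w1 w2 w3 => a b; set N := normc _ => we w1 w2 w3 bN aN.
have {}bN : `|b| <= N := bN; have {}aN : `|a| <= N := aN.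
have aN1 := le_lt_trans aN w1.
have bN2 := le_lt_trans bN w2.
have bN3 := le_lt_trans bN w3.
have := H1 a; have := H2 b; have := H3 b.
rewrite !subr0 sin0 cos0 expR0 !oppr0 mul0r !mul1r ?subr0 ?addr0.
move=> /(_ bN3) C3 /(_ bN2) C2 /(_ aN1) C1.
have N0 : 0 <= N by exact: normc_ge0.
have C1' : `|expR a - 1 - a| <= e' * N by rewrite (le_trans C1)// ler_pM2l.
have C2' : `|sin b - b| <= e' * N by rewrite (le_trans C2)// ler_pM2l.
have C3' : `|cos b - 1| <= e' * N by rewrite (le_trans C3)// ler_pM2l.
have N1 : N <= 1 by rewrite (le_trans (ltW we)).
have ee1 : `|expR a - 1| <= 2 * N.
  have -> : expR a - 1 = (expR a - 1 - a) + a by ring.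
  apply: le_trans (ler_normD _ _) _.
  by rewrite mulr2n mulrDl mul1r lerD// (le_trans C1')// ler_piMl.
have ee : `|expR a| <= 3.
  have -> : expR a = (expR a - 1) + 1 by ring.
  apply: le_trans (ler_normD _ _) _; rewrite normr1.
  by move: ee1 N1; lra.
apply: le_trans (normc_ReIm _) _.
have -> : complex.Re (cexp (a +i* b) - cexp 0 - (a +i* b)) = expR a * cos b - 1 - a.
  by rewrite /= expR0 cos0 mulr1.
have -> : complex.Im (cexp (a +i* b) - cexp 0 - (a +i* b)) = expR a * sin b - b.
  by rewrite /= sin0 mulr0 subr0.
have A1 : `|expR a * cos b - 1 - a| <= 4 * (e' * N).
  have -> : expR a * cos b - 1 - a = (expR a - 1 - a) + expR a * (cos b - 1) by ring.
  apply: le_trans (ler_normD _ _) _; rewrite normrM.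
  have : `|expR a| * `|cos b - 1| <= 3 * (e' * N) by rewrite ler_pM.
  by move: C1'; lra.
have A2 : `|expR a * sin b - b| <= 4 * (e' * N) + e' * N.
  have -> : expR a * sin b - b = expR a * (sin b - b) + (expR a - 1) * b by ring.
  apply: le_trans (ler_normD _ _) _; rewrite !normrM.
  have h1 : `|expR a| * `|sin b - b| <= 3 * (e' * N) by rewrite ler_pM.
  have h2 : `|expR a - 1| * `|b| <= (2 * N) * e'.
    by rewrite ler_pM// (le_trans bN)// ltW.
  by move: h1 h2; lra.
have eN : 9 * e' * N <= e * N by rewrite ler_wpM2r.
by move: A1 A2 eN; lra.
Qed.

End ComplexNorm.

(** * Liouville's theorem *)

Section Liouville.
Variable R : realType.
Implicit Types (z w : R[i]) (f h : R[i] -> R[i]).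
Notation normc := (@Normc.normc R).
Notation Re := (@complex.Re R).
Notation Im := (@complex.Im R).

Lemma ReB z w : Re (z - w) = Re z - Re w. Proof. by case: z w => [? ?] []. Qed.

Lemma ImB z w : Im (z - w) = Im z - Im w. Proof. by case: z w => [? ?] []. Qed.

Lemma Re_continuous : continuous Re.
Proof.
move=> z; apply/(@cvgrPdist_lt _ R^o _ (nbhs z)) => e e0.
apply/near_normcP; exists e => // w wz.
by rewrite distrC -ReB; exact: le_lt_trans (normc_Re _) wz.
Qed.

Lemma Im_continuous : continuous Im.
Proof.
move=> z; apply/(@cvgrPdist_lt _ R^o _ (nbhs z)) => e e0.
apply/near_normcP; exists e => // w wz.
by rewrite distrC -ImB; exact: le_lt_trans (normc_Im _) wz.
Qed.

Lemma complex_cvg (T : Type) (F : set_system T) (a b : T -> R) (x y : R) :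
  Filter F -> a @ F --> x -> b @ F --> y ->
  (fun t => a t +i* b t) @ F --> (x +i* y : R[i]).
Proof.
move=> FF ax bx; apply/cvgrPdist_lt; apply: complex_gt0_ind => e e0.
have e20 : 0 < e / 2 by rewrite divr_gt0.
near=> t.
rewrite norm_normc ltcR; apply: le_lt_trans (normc_ReIm _) _ => /=.
rewrite [e]splitr; apply: ltrD; near: t.
  by move/cvgrPdist_lt : ax => /(_ _ e20).
by move/cvgrPdist_lt : bx => /(_ _ e20).
Unshelve. all: by end_near. Qed.

Lemma is_derive_cexp z : is_derive z 1 (@cexp R) (cexp z).
Proof.
apply/complex_deriveP => e e0.
have e'0 : 0 < e / expR (Re z) by rewrite divr_gt0// expR_gt0.
have [r r0 H] := (complex_deriveP (@cexp R) 0 1).1 (is_derive_cexp0 R) _ e'0.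
exists r => // w wz; have := H (w - z); rewrite !subr0 => /(_ wz).
have c0 : cexp (0 : R[i]) = 1 by rewrite /cexp /= expR0 cos0 sin0 mulr1 mulr0.
rewrite c0 mul1r => {}H.
have -> : cexp w - cexp z - cexp z * (w - z) = cexp z * (cexp (w - z) - 1 - (w - z)).
  have -> : cexp w = cexp z * cexp (w - z) by rewrite -cexpD addrC subrK.
  ring.
rewrite Normc.normcM normc_cexp mulrC -ler_pdivlMr ?expR_gt0//.
by rewrite mulrAC.
Qed.

Definition holomorphic f := forall z, derivable f z 1.

(** Cauchy-Riemann: for [h = u + i v], the imaginary part of [h dz] is
[v dx + u dy], and the derivative [D] of [h] gives [v] and [u] the differentials
[(Im D, Re D)] and [(Re D, - Im D)], whence the symmetry. *)
Lemma holomorphic_closed h : holomorphic h ->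
  pointwise_closed (fun x y => Im (h (x +i* y))) (fun x y => Re (h (x +i* y))).
Proof.
move=> hol x0 y0; have [D /complex_deriveP H] := ex_intro _ _ (derivableP (hol (x0 +i* y0))).
exists (Im D), (Re D), (- Im D) => e e0.
have [r r0 Hr] := H _ e0; exists (r / 4); first by rewrite divr_gt0.
move=> x y xr yr; set w := x +i* y; set z := x0 +i* y0.
have wz : normc (w - z) <= `|x - x0| + `|y - y0| by exact: normc_ReIm.
have /Hr {}Hr : normc (w - z) < r by apply: le_lt_trans wz _; lra.
have ewz : e * normc (w - z) <= e * (`|x - x0| + `|y - y0|) by rewrite ler_pM2l.
have RE : Re (h w - h z - D * (w - z)) =
    Re (h w) - (Re (h z) + Re D * (x - x0) + - Im D * (y - y0)).
  rewrite /w /z; case: (h _) => ? ?; case: (h _) => ? ?; case: (D) => ? ? /=; ring.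
have IE : Im (h w - h z - D * (w - z)) =
    Im (h w) - (Im (h z) + Im D * (x - x0) + Re D * (y - y0)).
  rewrite /w /z; case: (h _) => ? ?; case: (h _) => ? ?; case: (D) => ? ? /=; ring.
split.
  by rewrite -IE; apply: le_trans (normc_Im _) (le_trans Hr ewz).
by rewrite -RE; apply: le_trans (normc_Re _) (le_trans Hr ewz).
Qed.

Lemma holomorphic_continuous h : holomorphic h -> continuous h.
Proof. by move=> hol z; apply/differentiable_continuous/derivable1_diffP. Qed.

Lemma holomorphic_continuous_each h (p : R[i] -> R) : continuous p -> holomorphic h ->
  continuous_each (fun x y => p (h (x +i* y))).
Proof.
move=> pc /holomorphic_continuous hc; split=> [y x|x y].
  apply: (continuous_comp (f := fun x => h (x +i* y))); last exact: pc.
  apply: (continuous_comp (f := fun x => x +i* y)); last exact: hc.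
  by apply: complex_cvg; [exact: cvg_id|exact: cvg_cst].
apply: (continuous_comp (f := fun y => h (x +i* y))); last exact: pc.
apply: (continuous_comp (f := fun y => x +i* y)); last exact: hc.
by apply: complex_cvg; [exact: cvg_cst|exact: cvg_id].
Qed.

(** Goursat's lemma on [a, b] x [0, 2 pi] for [h z = (f (exp z) - f 0) / exp z].
The horizontal sides cancel by periodicity, and [a -> -oo], [b -> +oo] make the
vertical ones tend to [Re f'(0)] and 0 times [2 pi]. *)
Lemma bounded_holomorphic_Re_derive0 f (M : R) (d : R[i]) : holomorphic f ->
  (forall z, normc (f z) <= M) -> is_derive (0 : R[i]) 1 f d -> Re d = 0.
Proof.
move=> hol fM /complex_deriveP fd.
have M0 : 0 <= M by apply: le_trans (fM 0); exact: normc_ge0.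
pose h z := (f (cexp z) - f 0) * (cexp z)^-1.
have hh : holomorphic h.
  move=> z; apply: (@derivableM _ _ (fun z => f (cexp z) - f 0) (fun z => (cexp z)^-1)).
    apply: derivableB; last exact: derivable_cst.
    apply/derivable1_diffP; apply: (@differentiable_comp _ _ _ _ (@cexp R) f);
    apply/derivable1_diffP; last exact: hol.
    by have [] := is_derive_cexp z.
  apply: (@derivableV _ _ (@cexp R)); first exact: cexp_neq0.
  by have [] := is_derive_cexp z.
pose P x y := Im (h (x +i* y)); pose Q x y := Re (h (x +i* y)).
have Pc : continuous_each P := holomorphic_continuous_each Im_continuous hh.
have Qc : continuous_each Q := holomorphic_continuous_each Re_continuous hh.
have per x : P x 0 = P x (2 * pi).
  suff E : cexp (x +i* 0) = cexp (x +i* (2 * pi)) by rewrite /P /h E.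
  by rewrite /cexp /= mulr_natl cos2pi sin2pi cos0 sin0.
have pi0 : 0 < 2 * pi :> R by rewrite mulr_gt0// pi_gt0.
have small e : 0 < e -> `|Re d| <= 2 * e.
  move=> e0.
  have [r r0 Hr] := fd _ e0.
  (* Both [exp a < r] and [2 M <= e exp b] follow from [1 + x <= exp x]. *)
  pose a := - r^-1; pose b := 2 * M / e.
  have a0 : a <= 0 by rewrite oppr_le0 invr_ge0 ltW.
  have b0 : 0 <= b by rewrite divr_ge0 ?mulr_ge0// ltW.
  have ar : expR a < r.
    rewrite expRN invf_plt ?posrE ?expR_gt0//.
    by apply: lt_le_trans (expR_ge1Dx _); rewrite ltrDr.
  have Qa y : `|Q a y - Re d| <= e.
    have := Hr (cexp (a +i* y)); rewrite !subr0 normc_cexp => /(_ ar) H.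
    have -> : Q a y - Re d =
       Re ((f (cexp (a +i* y)) - f 0 - d * cexp (a +i* y)) * (cexp (a +i* y))^-1).
      rewrite /Q /h -ReB; congr Re; field; exact: cexp_neq0.
    apply: le_trans (normc_Re _) _; rewrite Normc.normcM Normc.normcV normc_cexp.
    by rewrite ler_pdivrMr ?expR_gt0.
  have Qb y : `|Q b y| <= e.
    apply: le_trans (normc_Re _) _; rewrite Normc.normcM Normc.normcV normc_cexp.
    rewrite ler_pdivrMr ?expR_gt0//.
    apply: (@le_trans _ _ (2 * M)).
      apply: le_trans (le_normcD _ _) _; rewrite normcN mulr2n mulrDl mul1r.
      by rewrite lerD.
    rewrite -ler_pdivrMl// mulrC -/b; apply: le_trans (expR_ge1Dx _).
    by rewrite lerDr.
  have := goursat Pc Qc (holomorphic_closed hh) (le_trans a0 b0) (ltW pi0).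
  rewrite /circulation => C0.
  have I1 : segint (fun x => P x 0 - P x (2 * pi)) a b = 0.
    rewrite (_ : (fun _ => _) = fun=> 0); last by apply/funext => x; rewrite -per subrr.
    by rewrite /segint Rintegral_cst// mul0r.
  move: C0; rewrite I1 add0r => I2.
  have Qab : continuous (fun y => Q b y - Q a y).
    by move=> y; apply: cvgB; exact: Qc.2.
  have near_d y : 0 <= y <= 2 * pi -> `|Q b y - Q a y - - Re d| <= 2 * e.
    move=> _; move: (Qa y) (Qb y); rewrite !ler_norml => /andP[? ?] /andP[? ?].
    by apply/andP; split; lra.
  have := segint_near_cst Qab (ltW pi0) near_d.
  rewrite I2 subr0 sub0r mulNr opprK normrM [`|2 * pi|]gtr0_norm//.
  by rewrite ler_pM2r.
apply/eqP; rewrite -normr_le0; apply/ler_addgt0Pl => e e0; rewrite addr0.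
have := small (e / 2); rewrite divr_gt0// => /(_ isT); lra.
Qed.

Lemma mul_shrink (a e N : R) : 0 <= a -> 0 <= e -> 0 <= N ->
  a * (e / (a + 1) * N) <= e * N.
Proof.
move=> a0 e0 N0; have a1 : 0 < a + 1 by rewrite ltr_wpDl.
have -> : a * (e / (a + 1) * N) = e * N * (a / (a + 1)) by field; rewrite gt_eqF.
by rewrite ler_piMr ?mulr_ge0// ler_pdivrMr// mul1r lerDl.
Qed.

Lemma is_derive_scale_shift f c z w (d : R[i]) :
  is_derive (w + z) 1 f d -> is_derive w 1 (fun v => c * f (v + z)) (c * d).
Proof.
move=> /complex_deriveP fd; apply/complex_deriveP => e e0.
have e'0 : 0 < e / (normc c + 1) by rewrite divr_gt0// ltr_wpDl// normc_ge0.
have [r r0 H] := fd _ e'0; exists r => // v vr.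
have vw : v + z - (w + z) = v - w by rewrite opprD addrACA subrr addr0.
have := H (v + z); rewrite vw => /(_ vr) {}H.
rewrite -!mulrA -!mulrBr Normc.normcM.
apply: le_trans (mul_shrink (normc_ge0 c) (ltW e0) (normc_ge0 (v - w))).
by rewrite ler_wpM2l// normc_ge0.
Qed.

(** Applied to [w |-> c f (w + z)], the previous lemma kills [Re (c f'(z))] for
every [c]; the values [c = 1] and [c = i] suffice. *)
Lemma bounded_holomorphic_derive0 f (M : R) z (d : R[i]) : holomorphic f ->
  (forall z, normc (f z) <= M) -> is_derive z 1 f d -> d = 0.
Proof.
move=> hol fM fd.
have tr c : Re (c * d) = 0.
  pose g w := c * f (w + z).
  have gd : is_derive (0 : R[i]) 1 g (c * d).
    by apply: is_derive_scale_shift; rewrite add0r.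
  have gM w : normc (g w) <= normc c * M.
    by rewrite Normc.normcM ler_wpM2l// normc_ge0.
  apply: bounded_holomorphic_Re_derive0 gM gd => w.
  have /derivableP fw := hol (w + z).
  by have [] := is_derive_scale_shift c fw.
move: (tr 1) (tr 'i%C); rewrite mul1r; case: (d) => a b /= -> /eqP.
by rewrite mul0r mul1r sub0r oppr_eq0 => /eqP ->.
Qed.

(** The derivative vanishes everywhere; the real and imaginary parts of [f] along
the segment from 0 to [z] are then real functions with zero derivative. *)
Theorem liouville f (M : R) : holomorphic f -> (forall z, normc (f z) <= M) ->
  forall z, f z = f 0.
Proof.
move=> hol fM z.
have f0 w : is_derive w 1 f 0.
  by have /derivableP fd := hol w; rewrite -(bounded_holomorphic_derive0 hol fM fd).
have along (p : R[i] -> R) : (forall z w, p (z - w) = p z - p w) ->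
    (forall z, `|p z| <= normc z) -> p (f z) = p (f 0).
  move=> pB pn; pose g (t : R) := p (f (t%:C * z)).
  have -> : p (f z) = g 1 by rewrite /g mul1r.
  have -> : p (f 0) = g 0 by rewrite /g mul0r.
  apply: is_derive_0_is_cst => t; apply/is_derive_expansion => e e0.
  have e'0 : 0 < e / (normc z + 1) by rewrite divr_gt0// ltr_wpDl// normc_ge0.
  have [r r0 H] := (complex_deriveP _ _ _).1 (f0 (t%:C * z)) _ e'0.
  apply/nbhs_normP; exists (r / (normc z + 1)).
    by rewrite /= divr_gt0// ltr_wpDl// normc_ge0.
  move=> s /= ts; rewrite mul0r subr0 /g -pB.
  apply: le_trans (pn _) _.
  have := H (s%:C * z); rewrite mul0r subr0 -mulrBl -rmorphB Normc.normcM.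
  have -> : normc (s - t)%:C = `|s - t| by rewrite /= expr0n /= addr0 sqrtr_sqr.
  have nz1 : 0 < normc z + 1 by rewrite ltr_wpDl// normc_ge0.
  move: ts; rewrite distrC ltr_pdivlMr// => ts.
  have sr : `|s - t| * normc z < r.
    by apply: le_lt_trans ts; rewrite ler_wpM2l// lerDl.
  move=> /(_ sr) H'; apply: le_trans H' _.
  rewrite [_ * normc z]mulrC mulrCA.
  by apply: mul_shrink; [exact: normc_ge0|exact: ltW|].
apply/eqP; rewrite eq_complex; apply/andP; split; apply/eqP.
  by apply: along; [exact: ReB | exact: normc_Re].
by apply: along; [exact: ImB | exact: normc_Im].
Qed.

End Liouville.

(** * Quasi-periodic perturbations of the integers *)

Section Sites.
Variable R : realType.
Implicit Types (p q : R * R) (n m k : int) (x y v : R).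

(** A positive zero [k] of the sine is [m pi] with [m = floor (k / pi)], so an integer
zero would make [pi] rational. *)
Lemma sin_nat_neq0 (k : nat) : (0 < k)%N -> sin (k%:R : R) != 0.
Proof.
move=> k0; apply/eqP => sk; apply: (@pi_irrationnal R).
have pi0 : 0 < pi :> R by exact: pi_gt0.
pose m := Num.truncn (k%:R / pi : R).
have kpi0 : 0 <= k%:R / pi :> R by rewrite divr_ge0// ltW.
have /andP[m1 m2] := truncn_itv kpi0.
rewrite -/m in m1 m2.
have sinD_pin (x : R) j : sin (x + pi *+ j) = (-1) ^+ j * sin x.
  elim: j => [|j IH]; first by rewrite mulr0n addr0 expr0 mul1r.
  by rewrite mulrS [pi + _]addrC addrA sinDpi IH exprS mulN1r mulNr.
pose r := k%:R - pi *+ m : R.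
have r0 : 0 <= r by rewrite /r subr_ge0 -[pi *+ m]mulr_natl; move: m1; rewrite ler_pdivlMr.
have r1 : r < pi.
  by move: m2; rewrite /r ltrBlDr -[pi *+ m]mulr_natl -natr1 ltr_pdivrMr// mulrDl mul1r addrC.
have sr : sin r = 0.
  have := sinD_pin r m; rewrite /r subrK sk => /esym/eqP.
  by rewrite mulf_eq0 signr_eq0 /= => /eqP.
have kE : k%:R = pi *+ m :> R.
  apply/eqP; rewrite -subr_eq0 -/r; move: r0; rewrite le_eqVlt eq_sym => /orP[//|r0].
  by have := @sin_gt0_pi R r; rewrite r0 r1 sr ltxx => /(_ isT).
have m0 : m%:R != 0 :> R.
  by apply/eqP => m0; move/eqP: kE; rewrite -[pi *+ m]mulr_natl m0 mul0r pnatr_eq0 eqn0Ngt k0.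
apply/rationalP; exists (Posz k), m.
by rewrite -pmulrn kE -[pi *+ m]mulr_natr mulfK.
Qed.

Lemma sin_int_neq0 k : k != 0 -> sin (k%:~R : R) != 0.
Proof.
case: k => k k0; first by apply: sin_nat_neq0; rewrite lt0n.
by rewrite NegzE mulrNz sinN oppr_eq0; exact: (@sin_nat_neq0 k.+1).
Qed.

(** The pair [p] consists of an offset and a phase; the amplitude [1 / 8] keeps
consecutive sites at distance at least [3 / 4]. *)
Definition site p n : R := n%:~R - p.1 + cos (p.2 + 2 * n%:~R) / 8.

Definition sites p : set R := range (site p).

Lemma site_gap p n m : `|site p n - site p m - (n - m)%:~R| <= 1 / 4.
Proof.
rewrite /site intrB.
have := cos_max (p.2 + 2 * n%:~R); have := cos_max (p.2 + 2 * m%:~R).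
rewrite !ler_norml => /andP[? ?] /andP[? ?].
by apply/andP; split; lra.
Qed.

Lemma small_int_eq n m : `|n%:~R - m%:~R : R| < 1 -> n = m.
Proof.
rewrite -intrB -intr_norm -[1]/(1%:~R : R) ltr_int => h; apply/eqP.
by rewrite -subr_eq0 -normr_le0; move: h; lia.
Qed.

Lemma site_inj p n m : `|site p n - site p m| < 3 / 4 -> n = m.
Proof.
move=> h; apply: small_int_eq; have := site_gap p n m; move: h.
rewrite -intrB ltr_norml ler_norml ltr_norml => /andP[? ?] /andP[? ?].
by apply/andP; split; lra.
Qed.

Lemma sites_closed p : closed (sites p).
Proof.
move=> y cy.
have e0 : 0 < 1 / 4 :> R by [].
have [_ [[n _ <-] ny]] := cy _ (nbhsx_ballx y _ e0).
have [->|yn] := eqVneq y (site p n); first by exists n.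
pose r := Num.min (1 / 4) `|y - site p n|.
have r0 : 0 < r by rewrite lt_min e0 normr_gt0 subr_eq0.
have [_ [[m _ <-] my]] := cy _ (nbhsx_ballx y _ r0).
move: ny my; rewrite /ball /= lt_min => ny /andP[my mn].
exfalso; suff E : m = n by move: mn; rewrite E ltxx.
apply: (@site_inj p); move: ny my; rewrite !ltr_norml => /andP[? ?] /andP[? ?].
by apply/andP; split; lra.
Qed.

(** Translation by [v] sends the site numbered [n] to the one numbered [n + k], with
[k] independent of [n] because the displacements are small. Then
[cos (t + 2 (n + k)) - cos (t + 2 n) = - 2 sin (t + 2 n + k) sin k] does not depend
on [n]. If [k] is not 0, neither is [sin k], so [sin (t + 2 n + k)] is constant
in [n], which the rotation by 2 forbids. *)
Lemma sites_aperiodic p v : (forall n, sites p (site p n + v)) -> v = 0.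
Proof.
move=> H.
have [k Hk] : exists k, forall n, site p (n + k) = site p n + v.
  have [k _ Hk] := H 0; exists k => n; have [m _ Hm] := H n.
  rewrite -Hm; congr site; apply: small_int_eq; rewrite intrD.
  have := site_gap p k 0; have := site_gap p m n; rewrite Hk Hm !intrB.
  rewrite !ler_norml ltr_norml => /andP[? ?] /andP[? ?].
  by apply/andP; split; lra.
have [k0|k0] := eqVneq k 0.
  by have := Hk 0; rewrite k0 addr0 => /eqP; rewrite addrC -subr_eq subrr eq_sym => /eqP.
have sk := sin_int_neq0 k0.
pose t n : R := p.2 + 2 * n%:~R + k%:~R.
have cosB n : cos (p.2 + 2 * (n + k)%:~R) - cos (p.2 + 2 * n%:~R) = - 2 * sin (t n) * sin k%:~R.
  have -> : p.2 + 2 * (n + k)%:~R = t n + k%:~R by rewrite /t intrD; ring.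
  have -> : p.2 + 2 * n%:~R = t n - k%:~R by rewrite /t; ring.
  by rewrite cosD cosB; ring.
have tE n : - 2 * sin (t n) * sin k%:~R = 8 * (v - k%:~R).
  by rewrite -cosB; have := Hk n; rewrite /site intrD; lra.
have sint n : sin (t n) = sin (t 0).
  have := etrans (tE n) (esym (tE 0)); rewrite -!mulrA => /mulfI.
  by rewrite oppr_eq0 pnatr_eq0 => /(_ isT)/mulIf; apply.
(* From [sin (u + 1) = sin (u - 1)], [u = t n + 1]. *)
have cost n : cos (t n + 1) = 0.
  have : sin (t n + 1 + 1) = sin (t n + 1 - 1).
    rewrite addrK sint -(sint (n + 1)); congr sin; rewrite /t intrD; ring.
  rewrite sinD sinB => h; have /eqP : cos (t n + 1) * sin 1 = 0 by lra.
  rewrite mulf_eq0 => /orP[/eqP//|].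
  by rewrite (negbTE (@sin_nat_neq0 1 isT)).
have := cost 1; have -> : t 1 + 1 = t 0 + 1 + 2 by rewrite /t; ring.
rewrite cosD cost mul0r sub0r => /eqP; rewrite oppr_eq0 mulf_eq0.
rewrite (negbTE (@sin_nat_neq0 2 isT)) orbF => /eqP s0.
by have := cos2Dsin2 (t 0 + 1); rewrite cost s0 expr0n addr0 => /eqP; rewrite eq_sym oner_eq0.
Qed.

Lemma site_translate p n x : site (p.1 + x, p.2) n = site p n - x.
Proof. by rewrite /site /=; ring. Qed.

Lemma cosD_int (x : R) k : cos (x + 2 * pi * k%:~R) = cos x.
Proof.
have nat_case (y : R) (j : nat) : cos (y + 2 * pi * j%:R) = cos y.
  by rewrite mulr_natr [2 * pi]mulr_natl (periodicn (@cosD2pi R)).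
case: k => j; first exact: nat_case.
by rewrite NegzE mulrNz mulrN -(nat_case (_ - _) j.+1) subrK.
Qed.

(** Renumbering the sites by [n + m] moves the integer part [m] of the offset into
the phase, which is then reduced modulo [2 pi]. *)
Lemma sites_reduce p : exists2 q, sites p = sites q & (0 <= q.1 <= 1) /\ (0 <= q.2 <= 2 * pi).
Proof.
pose m := Num.floor p.1; pose ph := p.2 + 2 * m%:~R.
pose l := Num.floor (ph / (2 * pi)).
have pi0 : 0 < 2 * pi :> R by rewrite mulr_gt0// pi_gt0.
exists (p.1 - m%:~R, ph - 2 * pi * l%:~R); last first.
  have /andP[m1 m2] := floor_itv p.1.
  have /andP[] := floor_itv (ph / (2 * pi)).
  rewrite -/m -/l in m1 m2 *.
  rewrite ler_pdivlMr// ltr_pdivrMr// => l1 l2; rewrite !intrD /= in m2 l2.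
  split; apply/andP; split; rewrite /=; lra.
have E n : site (p.1 - m%:~R, ph - 2 * pi * l%:~R) n = site p (n + m).
  rewrite /site /= -(cosD_int (_ + _) l) intrD; congr (_ + cos _ / 8); rewrite /ph; ring.
apply/seteqP; split=> _ [n _ <-]; last by exists (n + m) => //; rewrite E.
by exists (n - m) => //; rewrite E subrK.
Qed.

Lemma site_continuous n : continuous (fun p => site p n).
Proof.
move=> p; rewrite /site; apply: cvgD.
  by apply: cvgB; [exact: cvg_cst|exact: cvg_fst].
apply: cvgM; last exact: cvg_cst.
apply: (continuous_comp (f := fun p : R * R => p.2 + 2 * n%:~R)); last exact: continuous_cos.
by apply: cvgD; [exact: cvg_snd|exact: cvg_cst].
Qed.

End Sites.

(** * A compact family of free divisors *)

Section Grid.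
Variable R : realType.
Implicit Types (p q : R * R) (z w : R[i]).
Notation normc := (@Normc.normc R).
Notation Re := (@complex.Re R).
Notation Im := (@complex.Im R).

Definition grid p q : set R[i] := [set z | sites p (Re z) /\ sites q (Im z)].

Lemma grid_separated p q z w : grid p q z -> grid p q w -> normc (z - w) < 3 / 4 -> z = w.
Proof.
move=> [[n _ nz] [n' _ n'z]] [[m _ mw] [m' _ m'w]] zw.
have h1 : `|site p n - site p m| < 3 / 4.
  by rewrite nz mw -ReB; exact: le_lt_trans (normc_Re _) zw.
have h2 : `|site q n' - site q m'| < 3 / 4.
  by rewrite n'z m'w -ImB; exact: le_lt_trans (normc_Im _) zw.
apply/eqP; rewrite eq_complex -nz -mw -n'z -m'w.
by rewrite (site_inj h1) (site_inj h2) !eqxx.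
Qed.

Lemma grid_closed p q : closed (grid p q).
Proof.
apply: closedI.
  by have /continuous_closedP := @Re_continuous R; apply; exact: sites_closed.
by have /continuous_closedP := @Im_continuous R; apply; exact: sites_closed.
Qed.

Definition grid_mult p q : R[i] -> nat := fun z => `[< grid p q z >].

Lemma div_support_grid p q : div_support (grid_mult p q) = grid p q.
Proof.
apply/seteqP; split=> z; rewrite /div_support /grid_mult /=; first by case: asboolP.
by move=> /asboolT ->.
Qed.

Lemma grid_mult_positive p q : positive_divisor R (grid_mult p q).
Proof.
rewrite /positive_divisor /= div_support_grid; split; first exact: grid_closed.
move=> z gz; split; first exact/mem_set.
exists [set w | normc (w - z) < 3 / 4]; first by apply/near_normcP; exists (3 / 4).
apply/seteqP; split=> [w [wz gw]|w ->]; first exact: (grid_separated gw gz wz).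
by split => //=; rewrite subrr Normc.normc0.
Qed.

Definition grid_divisor (pq : (R * R) * (R * R)) : divisor R :=
  SigSub (mem_set (grid_mult_positive pq.1 pq.2)).

(** A period [w] of the product set translates the first factor into itself by
[Re w] and the second one by [Im w]. *)
Lemma grid_divisor_free pq : free_divisor R (grid_divisor pq).
Proof.
case: pq => p q w /= /(congr1 (fun d => div_support d)) E.
have gE z : grid p q (z + w) = grid p q z.
  rewrite -(div_support_grid p q); exact: (congr1 (fun A : set R[i] => A z) E).
have Re0 : Re w = 0.
  apply: (@sites_aperiodic _ p) => n.
  have : grid p q (site p n +i* site q 0) by split; [exists n|exists 0].
  by rewrite -gE => -[]; case: (w).
have Im0 : Im w = 0.
  apply: (@sites_aperiodic _ q) => n.
  have : grid p q (site p 0 +i* site q n) by split; [exists 0|exists n].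
  by rewrite -gE => -[_]; case: (w).
by apply/eqP; rewrite eq_complex Re0 Im0 !eqxx.
Qed.

Definition free_grid pq : free_divisor R := 
  SigSub (@mem_set _ (free_divisor R) _ (@grid_divisor_free pq)).

Lemma free_divisor_ext (d1 d2 : free_divisor R) :
  multiplicity (sval d1) = multiplicity (sval d2) -> d1 = d2.
Proof. by move=> E; apply/val_inj/val_inj. Qed.

Lemma translate_free_grid w x th y ps :
  translate_free w (free_grid ((x, th), (y, ps))) =
  free_grid ((x + Re w, th), (y + Im w, ps)).
Proof.
apply: free_divisor_ext; apply/funext => z; rewrite /multiplicity /=.
rewrite /translate /grid_mult; congr (nat_of_bool _); apply: asbool_equiv_eq.
have sE (a t b v : R) : sites (a, t) (b + v) <-> sites (a + v, t) b.
  split=> -[n _]; first by move=> E; exists n => //; rewrite (site_translate (a, t)) E addrK.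
  by rewrite (site_translate (a, t)) => <-; exists n => //; rewrite subrK.
by rewrite /grid /=; case: z w => [zx zy] [wx wy] /=; split=> -[/sE h1 /sE h2].
Qed.

(** The family is the image of a compact set of parameters. *)
Lemma free_grid_reduce pq : exists2 pq', free_grid pq = free_grid pq' &
  ((0 <= pq'.1.1 <= 1) /\ (0 <= pq'.1.2 <= 2 * pi)) /\
  ((0 <= pq'.2.1 <= 1) /\ (0 <= pq'.2.2 <= 2 * pi)).
Proof.
have [p pE hp] := sites_reduce pq.1; have [q qE hq] := sites_reduce pq.2.
exists (p, q) => //; apply: free_divisor_ext; apply/funext => z.
by rewrite /multiplicity /= /grid_mult /grid pE qE.
Qed.

Definition int_of_ord (N : nat) (i : 'I_(N.*2.+1)) : int := i%:Z - N%:Z.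

(** When [f] vanishes at all sites with an index beyond [N], the pairing is a sum
over a fixed finite index set, in which only the sites move with the
parameters. *)
Lemma pairing_grid pq (f : test_function R) (N : nat) :
  (forall n m, sval f (site pq.1 n +i* site pq.2 m) != 0 ->
     (`|n| <= N)%N /\ (`|m| <= N)%N) ->
  pairing (grid_divisor pq) f =
  \sum_(ij : 'I_(N.*2.+1) * 'I_(N.*2.+1))
    sval f (site pq.1 (int_of_ord ij.1) +i* site pq.2 (int_of_ord ij.2)).
Proof.
case: pq => p q /= H.
pose pt (ij : 'I_(N.*2.+1) * 'I_(N.*2.+1)) : R[i] :=
  site p (int_of_ord ij.1) +i* site q (int_of_ord ij.2).
have pt_inj : injective pt.
  move=> [i j] [i' j'] [/eqP E1 /eqP E2].
  have h1 : int_of_ord i = int_of_ord i'.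
    by apply: (@site_inj _ p); move: E1; rewrite -subr_eq0 => /eqP ->; rewrite normr0.
  have h2 : int_of_ord j = int_of_ord j'.
    by apply: (@site_inj _ q); move: E2; rewrite -subr_eq0 => /eqP ->; rewrite normr0.
  by congr (_, _); apply: ord_inj; move: h1 h2; rewrite /int_of_ord; lia.
have gpt ij : grid p q (pt ij) by split; [exists (int_of_ord ij.1)|exists (int_of_ord ij.2)].
rewrite /pairing (fsbigE [seq pt ij | ij <- index_enum _])//=; first last.
- move=> z _ zN; have [gz|] := pselect (grid p q z); last first.
    by move=> /asboolF; rewrite /grid_mult => ->; rewrite mulr0.
  have [->|fz] := eqVneq (sval f z) 0; first by rewrite mul0r.
  exfalso; move: zN => /negP; apply.
  have [[n _ nz] [m _ mz]] := gz.
  have zE : z = site p n +i* site q m by rewrite nz mz; case: (z).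
  have [nN mN] : (`|n| <= N)%N /\ (`|m| <= N)%N by apply: H; rewrite -zE.
  have ex (k : int) : (`|k| <= N)%N -> exists i : 'I_(N.*2.+1), int_of_ord i = k.
    move=> kN; have h : (`|(k + N%:Z)%R| < N.*2.+1)%N by lia.
    by exists (Ordinal h); rewrite /int_of_ord /=; lia.
  have [i iE] := ex _ nN; have [j jE] := ex _ mN.
  by apply/mapP; exists (i, j); rewrite ?mem_index_enum// /pt /= iE jE.
- by rewrite map_inj_uniq ?index_enum_uniq.
rewrite big_map.
apply: eq_big => [ij|ij _]; first by rewrite in_setT.
by rewrite /multiplicity /grid_mult (asboolT (gpt ij)) mulr1.
Qed.

End Grid.

Lemma continuous_ptws (X : topologicalType) (T : Type) (V : topologicalType)
    (f : X -> {ptws T -> V}) :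
  (forall t, continuous (fun x => f x t)) -> continuous f.
Proof.
move=> fc x; apply/cvg_sup => t U.
have /= -> := @nbhsE (initial_topology (fun g : T -> V => g t)) (f x).
case=> B [[C oC <-] Cx] /filterS; apply; apply: (fc t x).
exact: open_nbhs_nbhs.
Qed.

(** * Equivariant maps are constant on the family *)

Section Family.
Variable R : realType.
Implicit Types (z w : R[i]).
Notation normc := (@Normc.normc R).
Notation Re := (@complex.Re R).
Notation Im := (@complex.Im R).

Lemma compact_real_bounded (X : topologicalType) (A : set X) (g : X -> R) :
  compact A -> continuous g -> exists M : R, forall x, A x -> `|g x| <= M.
Proof.
move=> cA cg; have /compact_bounded[M [_ HM]] :=
  continuous_compact (continuous_subspaceT cg) cA.
exists (M + 1) => x Ax; apply: (HM (M + 1)); first by rewrite ltrDl.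
by exists x.
Qed.

Lemma test_function_bounded (f : test_function R) : exists M : R, forall z,
  sval f z != 0 -> `|Re z| <= M /\ `|Im z| <= M.
Proof.
have [_ cf] := set_mem (valP f).
have [M1 H1] := compact_real_bounded cf (@Re_continuous R).
have [M2 H2] := compact_real_bounded cf (@Im_continuous R).
exists (Num.max M1 M2) => z fz.
have cz : closure [set z | sval f z != 0] z by exact: subset_closure.
by rewrite !le_max H1// H2// orbT.
Qed.

Lemma site_index_bound (p : R * R) (n : int) (M C : R) (N : nat) :
  `|site p n| <= M -> `|p.1| <= C -> M + C + 1 <= N%:R -> (`|n| <= N)%N.
Proof.
move=> sM pC MN.
have : `|n%:~R : R| <= N%:R.
  have := cos_max (p.2 + 2 * n%:~R); move: sM pC MN; rewrite /site !ler_norml.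
  by move=> /andP[? ?] /andP[? ?] ? /andP[? ?]; apply/andP; split; lra.
by rewrite -intr_norm -[N%:R]/(N%:Z%:~R) ler_int; lia.
Qed.

(** Near given parameters, a single bound [N] on the indices serves all the nearby
divisors, so the pairing with a test function is locally a fixed finite sum of
continuous functions. *)
Lemma grid_divisor_continuous : continuous (@grid_divisor R).
Proof.
apply: continuous_comp_initial; apply: continuous_ptws => f pq0.
have [M HM] := test_function_bounded f.
pose C : R := `|pq0.1.1| + `|pq0.2.1| + 1.
pose N := (Num.truncn (M + C + 1)).+1.
have NE : M + C + 1 <= N%:R by rewrite ltW// truncnS_gt.
pose g (pq : (R * R) * (R * R)) := \sum_(ij : 'I_(N.*2.+1) * 'I_(N.*2.+1))
    sval f (site pq.1 (int_of_ord ij.1) +i* site pq.2 (int_of_ord ij.2)).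
have gc : continuous g.
  apply: continuous_big => [|ij _]; first exact: add_continuous.
  have [cf _] := set_mem (valP f).
  move=> pq; apply: (continuous_comp (f := fun pq : (R * R) * (R * R) =>
    site pq.1 (int_of_ord ij.1) +i* site pq.2 (int_of_ord ij.2))); last exact: cf.
  apply: complex_cvg.
    by apply: (continuous_comp (f := fst) (g := fun p => site p _)); [exact: cvg_fst|exact: site_continuous].
  by apply: (continuous_comp (f := snd) (g := fun p => site p _)); [exact: cvg_snd|exact: site_continuous].
have near_g : \forall pq \near pq0, g pq = pairing (grid_divisor pq) f.
  have c1 : (fun pq : (R * R) * (R * R) => pq.1.1) @ pq0 --> pq0.1.1.
    by apply: (continuous_comp (f := fst) (g := fst)); exact: cvg_fst.
  have c2 : (fun pq : (R * R) * (R * R) => pq.2.1) @ pq0 --> pq0.2.1.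
    by apply: (continuous_comp (f := snd) (g := fst)); [exact: cvg_snd|exact: cvg_fst].
  have /cvgrPdist_lt/(_ 1 ltr01) n1 := c1; have /cvgrPdist_lt/(_ 1 ltr01) n2 := c2.
  near=> pq.
  have h1 : `|pq0.1.1 - pq.1.1| < 1 by near: pq.
  have h2 : `|pq0.2.1 - pq.2.1| < 1 by near: pq.
  apply/esym/pairing_grid => n m /HM[/= nM mM].
  have hC (a b c : R) : `|a - b| < 1 -> 0 <= c -> `|b| <= `|a| + c + 1.
    move=> ab c0; have -> : b = a - (a - b) by ring.
    by have := ler_normB a (a - b); lra.
  split; apply: (site_index_bound _ _ NE); try eassumption.
    by rewrite /C; apply: hC.
  by rewrite /C [`|pq0.1.1| + _]addrC; apply: hC.
have := gc pq0; rewrite /continuous_at (nbhs_singleton near_g).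
apply: cvg_trans; apply: near_eq_cvg; exact: near_g.
Unshelve. all: by end_near. Qed.

Lemma free_grid_continuous : continuous (@free_grid R).
Proof. by apply: continuous_comp_initial; exact: grid_divisor_continuous. Qed.

Lemma eval0_continuous (A : set {family compact, R[i] -> R[i]}) :
  continuous (fun f : A => (sval f : R[i] -> R[i]) 0).
Proof.
move=> f; have vc : (sval : A -> {family compact, R[i] -> R[i]}) @ f --> sval f.
  exact: (@initial_continuous A {family compact, R[i] -> R[i]} set_val f).
have ec : (fun h : {family compact, R[i] -> R[i]} => (h : R[i] -> R[i]) 0) @ sval f -->
    (sval f : R[i] -> R[i]) 0.
  move=> E nE; have := @proj_continuous _ (fun _ : R[i] => R[i]) 0 (sval f) E nE.
  exact: (@pointwise_cvg_compact_family _ _ (nbhs (sval f))).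
exact: cvg_comp vc ec.
Qed.

(** By [be], the value of [b d] at [w] is the value at 0 of [b] on a translate of
[d]. All translates are parametrised by one compact set, on which
[pq |-> b (free_grid pq) 0] is continuous, hence bounded. *)
Theorem equivariant_constant (A : set {family compact, R[i] -> R[i]})
    (b : free_divisor R -> A) : A `<=` entire R ->
  continuous b -> equivariant b ->
  forall pq z, (sval (b (free_grid pq)) : R[i] -> R[i]) z = sval (b (free_grid pq)) 0.
Proof.
move=> Aent bc be pq.
pose g pq' : R[i] := (sval (b (free_grid pq')) : R[i] -> R[i]) 0.
have gc : continuous g.
  move=> pq'; apply: (@continuous_comp _ _ _ (fun pq' => b (free_grid pq'))
    (fun f : A => (sval f : R[i] -> R[i]) 0)).
    apply: (continuous_comp (f := @free_grid R)); last exact: bc.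
    exact: free_grid_continuous.
  exact: eval0_continuous.
pose K1 : set (R * R) := `[0, 1] `*` `[0, 2 * pi].
have cK : compact (K1 `*` K1).
  by apply: compact_setX; apply: compact_setX; exact: segment_compact.
have [M1 H1] := compact_real_bounded cK (g := Re \o g)
  (fun x => continuous_comp (gc x) (@Re_continuous R (g x))).
have [M2 H2] := compact_real_bounded cK (g := Im \o g)
  (fun x => continuous_comp (gc x) (@Im_continuous R (g x))).
have gM pq' : normc (g pq') <= M1 + M2.
  have [[p q] E [/= [p1 p2] [q1 q2]]] := free_grid_reduce pq'.
  rewrite /g E -/(g (p, q)); apply: le_trans (normc_ReIm _) _.
  have K : (K1 `*` K1) (p, q) by split; split; rewrite /= in_itv.
  by apply: lerD; [exact: H1|exact: H2].
apply: (@liouville R _ (M1 + M2)).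
  by have := Aent _ (set_mem (valP (b (free_grid pq)))).
move=> w; case: pq => -[x th] [y ps].
have -> : (sval (b (free_grid ((x, th), (y, ps)))) : R[i] -> R[i]) w =
    g ((x + Re w, th), (y + Im w, ps)).
  by rewrite /g -translate_free_grid be /translate add0r.
exact: gM.
Qed.

Lemma div_constant (f : R[i] -> R[i]) (c : R[i]) z :
  (forall w, f w = c) -> c != 0 -> div f z = 0%N.
Proof.
move=> fc c0; rewrite /div; case: xgetP => // n _ [_ nmin].
by case: n nmin => // n /(_ 0%N isT) /=; rewrite fc => /eqP; rewrite (negbTE c0).
Qed.

End Family.

Theorem theorem6p4 (R : realType) :
  (~ exists beta : free_divisor R -> nonconstant_entire R,
       continuous beta /\ equivariant beta) /\
  (~ exists xi : free_divisor R -> nonzero_entire R,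
       [/\ continuous xi, equivariant xi &
           forall d : free_divisor R, div (sval (xi d)) = multiplicity (sval d)]).
Proof.
pose d0 : free_divisor R := free_grid ((0, 0), (0, 0)).
split=> [[beta [bc be]]|[xi [xc xe xdiv]]].
  have [_ nc] := set_mem (valP (beta d0)).
  apply: nc; exists ((sval (beta d0) : R[i] -> R[i]) 0).
  by apply: equivariant_constant => // f [].
have [_ nz] := set_mem (valP (xi d0)).
have const := equivariant_constant (fun f (H : nonzero_entire R f) => proj1 H) xc xe ((0, 0), (0, 0)).
have c0 : (sval (xi d0) : R[i] -> R[i]) 0 != 0.
  by apply/eqP => c0; apply: nz => z; exact: etrans (const z) c0.
have d00 z : multiplicity (sval d0) z = 0%N.
  by rewrite -xdiv; exact: div_constant const c0.
have := set_mem (valP d0) 1; have -> : translate 1 (multiplicity (sval d0)) = multiplicity (sval d0).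
  by apply/funext => z; rewrite /translate !d00.
by move=> /(_ erefl)/eqP; rewrite oner_eq0.
Qed.
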